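(* Let $d\neq 0$, $\kappa>0$, $\zeta,f\in\mathbb{R}$ (with $d\in\mathbb{R}$) and let $$\kappa^\star:=6\sqrt6\,\bigl(1+2\pi^2f^2|d|^{-1}\bigr)^3f^2.$$ Then all solutions $a$ of $$-da''-(\mathrm{i}-\zeta)a-(1+\mathrm{i}\kappa)|a|^2a+\mathrm{i}f=0,\qquad a(\cdot)=a(\cdot+2\pi),$$ are constant provided $\kappa>\kappa^\star$.
   Context: Solutions are complex-valued $2\pi$-periodic functions $a\in H^2(\mathbb{T})$, where $\mathbb{T}$ is the one-dimensional torus, i.e. $[0,2\pi]$ with both ends identified (all such solutions are smooth). *)

(* Defs.v *)
From mathcomp Require Import all_boot all_order all_algebra.
From mathcomp Require Import complex.
From mathcomp Require Import all_classical all_reals all_analysis.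

Set Implicit Arguments.
Unset Strict Implicit.
Unset Printing Implicit Defensive.

Import Order.TTheory GRing.Theory Num.Theory.
Import numFieldNormedType.Exports.

Local Open Scope classical_set_scope.
Local Open Scope ring_scope.
Local Open Scope complex_scope.

Section torus.
Context {R : realType}.
Implicit Types (a u v : R -> R[i]) (phi : R -> R).

(* A complex-valued function on the torus is represented by a 2 pi-periodic
   function on R, and an element of a Lebesgue or Sobolev space by any
   representative of its class modulo equality almost everywhere. *)

Definition torus_integral u : R[i] :=
  (\int[lebesgue_measure]_(x in `[0, 2 * pi]) complex.Re (u x))%R +i*
  (\int[lebesgue_measure]_(x in `[0, 2 * pi]) complex.Im (u x))%R.

Definition torus_L2 u : Prop :=
  [/\ periodic u (2 * pi),
      measurable_fun [set: R] (fun x => complex.Re (u x)),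
      measurable_fun [set: R] (fun x => complex.Im (u x)) &
      (\int[lebesgue_measure]_(x in `[0%R, (2 * pi)%R])
         (complex.Re (`|u x| ^+ 2))%:E < +oo)%E].

(* Real-valued test functions are enough: by linearity, the identity in
   weak_derivative below then holds for complex-valued ones. *)
Definition torus_test phi : Prop :=
  periodic phi (2 * pi) /\
  forall n (x : R), derivable (derive1n n phi : R -> R) x 1.

Definition weak_derivative (k : nat) u v : Prop :=
  forall phi, torus_test phi ->
    torus_integral (fun x => (derive1n k phi x)%:C * u x) =
    (-1) ^+ k * torus_integral (fun x => (phi x)%:C * v x).

Definition torus_sobolev (k : nat) u : Prop :=
  torus_L2 u /\
  forall j, (j <= k)%N -> exists v, torus_L2 v /\ weak_derivative j u v.

(* a'' is the second weak derivative, an element of L^2, so that the equation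
   is an identity in L^2, i.e., almost everywhere. *)
Definition lle_solution (d zeta kappa f : R) a : Prop :=
  torus_sobolev 2 a /\
  exists a'' : R -> R[i],
    [/\ torus_L2 a'', weak_derivative 2 a a'' &
        {ae lebesgue_measure, forall x : R,
          - (d%:C * a'' x) - ('i%C - zeta%:C) * a x
          - (1 + 'i%C * kappa%:C) * `|a x| ^+ 2 * a x + 'i%C * f%:C = 0}].

Definition kappa_star (d f : R) : R :=
  6 * Num.sqrt 6 * (1 + 2 * pi ^+ 2 * f ^+ 2 * `|d|^-1) ^+ 3 * f ^+ 2.

(* For the smooth (or merely continuous) representative of a, this means that
   a x = c for every x. *)
Definition torus_constant a : Prop :=
  exists c : R[i], {ae lebesgue_measure, forall x : R, a x = c}.

End torus.

(* Main.v *)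
Require Import Defs.
From mathcomp Require Import all_boot all_order all_algebra.
From mathcomp Require Import complex.
From mathcomp Require Import all_classical all_reals all_analysis.
From mathcomp Require Import measurable_realfun ring lra.

(** Write a = b + i c, r = |a|^2, q = |a'|^2, and split conj(a) a' into its real
    part p and its imaginary part g, so that p^2 + g^2 = r q.

    The heart of the matter is the function Psi = d Im(a'' conj(a')), for which the
    equation gives
      Psi' = - q + 2 p g - kappa (3 p^2 + g^2);
    integrated over a period, this is the imaginary part of the equation tested
    against conj(a'').
    As 2 p g <= p^2 + g^2 = r q, the right-hand side is at most - q when
    kappa >= 1, and at most - (1 - M) q when r <= M.  If M < 1, the periodic
    function Psi is monotone in both cases, hence constant, which forces q = 0:
    the solution is constant.  (These two steps are Psi_dissipative and
    lle_classical_constant.)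

    There remains to bound r when kappa_star < kappa < 1, and this bound need not
    improve as kappa grows:
    - (d g)' = - r - kappa r^2 + f b <= f^2 / 2 - r / 2, so the integral of r over
      a period is at most 2 pi f^2 (R_bound);
    - the energy (d/2) q - (zeta/2) r + r^2/4 - f c has derivative
      - (1 + kappa r) g, so that g vanishes somewhere by Rolle's theorem (g_zero),
      and (d g)' <= f^2 / 4 then gives |g| <= G := pi f^2 / (2 |d|) everywhere;
    - inserting this in the formula for Psi' bounds the integral of q by
      8 pi G^2 f^2 (Q_bound), and integrating r' = 2 p from a point where r does
      not exceed its mean value yields r <= f^2 (1 + 4 pi^2 f^2 / |d|) (r_bound).
    With B = 1 + 2 pi^2 f^2 / |d| this is at most f^2 B^2 <= kappa_star < 1.

    All this needs a classical solution, whereas only a weak one is given.  Testing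
    with trigonometric polynomials is enough to gain regularity: the difference
    between a and a double primitive of a'' is orthogonal to all second derivatives
    of trigonometric polynomials, and those determine an integrable function up to
    an additive constant (weak_derivative2_eq0).  Hence a agrees almost everywhere
    with a C^1 function, the equation makes a'' agree almost everywhere with a
    continuous function, and the solution is of class C^2
    (weak_derivative2_regular). *)

Set Implicit Arguments.
Unset Strict Implicit.
Unset Printing Implicit Defensive.
Import Order.TTheory GRing.Theory Num.Theory.
Import numFieldNormedType.Exports.
Local Open Scope classical_set_scope.
Local Open Scope ring_scope.

(** * Integration by parts against an indefinite integral *)

Section IntegrationByParts.
Variable R : realType.
Notation mu := (@lebesgue_measure R).
Implicit Types (a b c C : R) (s ds g h v : R -> R).

Lemma within_continuous_bounded a b s : {within `[a, b], continuous s} ->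
  exists2 C, 0 <= C & forall x, a <= x <= b -> `|s x| <= C.
Proof.
move=> cs.
have /compact_bounded[M [_ HM]] : compact (s @` `[a, b]).
  by apply: continuous_compact => //; exact: segment_compact.
exists (`|M| + 1); first by rewrite addr_ge0.
move=> x axb; apply: HM; last by exists x => //=; rewrite in_itv.
by rewrite (le_lt_trans (ler_norm M))// ltrDl.
Qed.

Lemma within_continuous_integrable a b s : {within `[a, b], continuous s} ->
  mu.-integrable `[a, b] (EFin \o s).
Proof.
by move=> cs; apply: continuous_compact_integrable => //; exact: segment_compact.
Qed.

Lemma within_continuous_integrableM a b s v : {within `[a, b], continuous s} ->
  mu.-integrable `[a, b] (EFin \o v) ->
  mu.-integrable `[a, b] (EFin \o (fun x => s x * v x)).
Proof.
move=> cs iv; rewrite (_ : _ \o _ = (EFin \o s) \* (EFin \o v))%E; last first.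
  by apply/funext => x /=; rewrite EFinM.
apply: integrableMr => //.
  by apply: subspace_continuous_measurable_fun.
have [C C0 HC] := within_continuous_bounded cs.
exists C; split; first exact: num_real.
by move=> M CM x /= xab; rewrite (le_trans _ (ltW CM))// HC.
Qed.

Lemma integrable_prefix a b x v : x <= b ->
  mu.-integrable `[a, b] (EFin \o v) -> mu.-integrable `[a, x] (EFin \o v).
Proof. by move=> xb; apply: integrableS => //; apply: subset_itvl. Qed.

Lemma Rintegral_prefix_le a b x h : x <= b ->
  mu.-integrable `[a, b] (EFin \o h) ->
  `|\int[mu]_(t in `[a, x]) h t| <= \int[mu]_(t in `[a, b]) `|h t|.
Proof.
move=> xb ih; have ihx := integrable_prefix xb ih.
apply: (le_trans (le_normr_Rintegral _ ihx)) => //.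
have ia : mu.-integrable `[a, b] (EFin \o (fun t => `|h t|)).
  by move: ih => /integrable_norm.
rewrite /Rintegral fine_le//.
- by apply: integrable_fin_num => //; exact: (integrable_prefix xb ia).
- exact: integrable_fin_num.
- apply: ge0_subset_integral => //=.
  by case/integrableP : ia.
  exact: subset_itvl.
Qed.

Lemma Rintegral_itv_cst a b c : a <= b -> \int[mu]_(x in `[a, b]) c = c * (b - a).
Proof.
move=> ab; rewrite Rintegral_cst//= lebesgue_measure_itv/= lte_fin.
by move: ab; rewrite le_eqVlt => /predU1P[->|->]//=; rewrite ltxx subrr.
Qed.

Lemma le_norm_RintegralM a b s h C : {within `[a, b], continuous s} ->
  (forall x, a <= x <= b -> `|s x| <= C) -> mu.-integrable `[a, b] (EFin \o h) ->
  `|\int[mu]_(x in `[a, b]) (s x * h x)| <= C * \int[mu]_(t in `[a, b]) `|h t|.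
Proof.
move=> cs HC ih.
have ia : mu.-integrable `[a, b] (EFin \o (fun t => `|h t|)).
  by move: ih => /integrable_norm.
have im := within_continuous_integrableM cs ih.
rewrite (le_trans (le_normr_Rintegral _ im))// -RintegralZl//.
apply: le_Rintegral => //.
- by move: im => /integrable_norm.
- rewrite (_ : _ \o _ = (fun x => C%:E * (`|h x|)%:E)%E).
    exact: (integrableZl _ C ia).
  by apply/funext => x /=; rewrite EFinM.
- by move=> x /=; rewrite in_itv/= => xab; rewrite normrM ler_wpM2r// HC.
Qed.

Lemma Rintegral_continuous a b v : a <= b -> mu.-integrable `[a, b] (EFin \o v) ->
  {within `[a, b], continuous (fun x => \int[mu]_(t in `[a, x]) v t)}.
Proof. exact: parameterized_integral_continuous. Qed.

(** The defect in the integration by parts formula is continuous in L^1, so the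
    formula only has to be checked on a dense set of integrands. *)
Lemma ibp_defect_le a b s (ds : R -> R) : a <= b ->
  {within `[a, b], continuous s} -> {within `[a, b], continuous ds} ->
  exists2 K, 0 <= K & forall h, mu.-integrable `[a, b] (EFin \o h) ->
  `|\int[mu]_(x in `[a, b]) (s x * h x) - s b * (\int[mu]_(t in `[a, b]) h t)
    + \int[mu]_(x in `[a, b]) (ds x * \int[mu]_(t in `[a, x]) h t)|
  <= K * \int[mu]_(t in `[a, b]) `|h t|.
Proof.
move=> ab cs cds.
have [C C0 HC] := within_continuous_bounded cs.
have [D D0 HD] := within_continuous_bounded cds.
exists (C + C + D * (b - a)); first by rewrite !addr_ge0// mulr_ge0// subr_ge0.
move=> h ih; set A := \int[mu]_(t in `[a, b]) `|h t|.
have A0 : 0 <= A by apply: Rintegral_ge0.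
have cH := Rintegral_continuous ab ih.
have iH := within_continuous_integrable cH.
rewrite 2!mulrDl.
apply: (le_trans (ler_normD _ _)); apply: lerD.
  apply: (le_trans (ler_normB _ _)); apply: lerD; first exact: le_norm_RintegralM.
  by rewrite normrM ler_pM// ?HC ?ab ?lexx//; apply: Rintegral_prefix_le.
apply: (le_trans (le_norm_RintegralM cds HD iH)).
rewrite -mulrA ler_wpM2l// mulrC -Rintegral_itv_cst//.
apply: le_Rintegral => //.
- by move: iH => /integrable_norm.
- apply: within_continuous_integrable => x; exact: cst_continuous.
- by move=> x /=; rewrite in_itv/= => /andP[_ xb]; apply: Rintegral_prefix_le.
Qed.

Lemma continuous_ibp a b s ds g : a < b ->
  (forall x : R, is_derive x 1 s (ds x)) -> continuous ds -> continuous g ->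
  \int[mu]_(x in `[a, b]) (s x * g x) = s b * (\int[mu]_(t in `[a, b]) g t)
    - \int[mu]_(x in `[a, b]) (ds x * \int[mu]_(t in `[a, x]) g t).
Proof.
move=> ab Ds cds cg.
have wg c d : {within `[c, d], continuous g} by apply: continuous_subspaceT.
have ig c d : mu.-integrable `[c, d] (EFin \o g) by exact: within_continuous_integrable.
set G := fun x => \int[mu]_(t in `[a, x]) g t.
have cG := Rintegral_continuous (ltW ab) (ig a b).
have cs : continuous s.
  by move=> x; apply/differentiable_continuous/derivable1_diffP; apply: ex_derive.
rewrite (@Rintegration_by_parts R s G ds g a b)//.
- by rewrite {2}/G set_itv1 Rintegral_set1 mulr0 subr0.
- exact: continuous_subspaceT.
- split; first by move=> x _; apply: ex_derive.
  + by apply: cvg_at_right_filter; exact: cs.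
  + by apply: cvg_at_left_filter; exact: cs.
- by move=> x _; rewrite derive1E; apply: derive_val.
- have /(continuous_within_itvP _ ab)[_ ca cb] := cG.
  split => // x; rewrite in_itv/= => /andP[ax xb].
  by have [] := @continuous_FTC1_closed R g a x b xb (ig _ _) ax (cg x).
- move=> x; rewrite in_itv/= => /andP[ax xb].
  by have [] := @continuous_FTC1_closed R g a x b xb (ig _ _) ax (cg x).
Qed.

(** An indefinite integral need not be differentiable everywhere; continuous
    functions being dense in L^1, the formula extends from them to all integrable
    functions by ibp_defect_le. *)
Lemma integrable_ibp a b s ds v : a < b ->
  (forall x : R, is_derive x 1 s (ds x)) -> continuous ds ->
  mu.-integrable `[a, b] (EFin \o v) ->
  \int[mu]_(x in `[a, b]) (s x * v x) = s b * (\int[mu]_(t in `[a, b]) v t)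
    - \int[mu]_(x in `[a, b]) (ds x * \int[mu]_(t in `[a, x]) v t).
Proof.
move=> ab Ds cds iv.
have cs : continuous s.
  by move=> x; apply/differentiable_continuous/derivable1_diffP; apply: ex_derive.
have wcs : {within `[a, b], continuous s} by exact: continuous_subspaceT.
have wcds : {within `[a, b], continuous ds} by exact: continuous_subspaceT.
have [K K0 HK] := ibp_defect_le (ltW ab) wcs wcds.
have mJ : (mu `[a, b]%classic < +oo)%E.
  by rewrite lebesgue_measure_itv/= lte_fin ab ltry.
have [g [cg ig g0]] := approximation_continuous_integrable (measurable_itv _) mJ iv.
apply/eqP; rewrite -subr_eq0 opprB addrA; apply/eqP.
set E := (X in X = 0).
have iB n : mu.-integrable `[a, b] (EFin \o (fun x => v x - g n x)).
  rewrite (_ : _ \o _ = (EFin \o v) \- (EFin \o g n))%E; last first.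
    by apply/funext => x /=; rewrite EFinB.
  exact: integrableB.
have bound n : `|E| <= K * \int[mu]_(t in `[a, b]) `|v t - g n t|.
  have := HK _ (iB n); congr (`| _ | <= _).
  have Eg := continuous_ibp ab Ds cds (cg n).
  (* The defect of g n is zero, so it may be subtracted from that of v. *)
  rewrite -[RHS]subr0 -(subrr (\int[mu]_(x in `[a, b]) (s x * g n x))) {2}Eg.
  rewrite [X in X - _](_ : _ = \int[mu]_(x in `[a, b]) (s x * v x)
      - \int[mu]_(x in `[a, b]) (s x * g n x)); last first.
    rewrite -RintegralB//; [|exact: within_continuous_integrableM..].
    by apply: eq_Rintegral => x _; rewrite mulrBr.
  rewrite RintegralB//.
  rewrite [X in _ + X](_ : _ =
     \int[mu]_(x in `[a, b]) (ds x * \int[mu]_(t in `[a, x]) v t)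
   - \int[mu]_(x in `[a, b]) (ds x * \int[mu]_(t in `[a, x]) g n t)); last first.
    rewrite -RintegralB//; last 2 first.
    - apply: within_continuous_integrableM => //; apply: within_continuous_integrable.
      exact: Rintegral_continuous (ltW ab) iv.
    - apply: within_continuous_integrableM => //; apply: within_continuous_integrable.
      exact: Rintegral_continuous (ltW ab) (ig n).
    apply: eq_Rintegral => x; rewrite inE/= in_itv/= => /andP[_ xb].
    rewrite -mulrBr RintegralB//.
      exact: integrable_prefix xb iv.
    exact: integrable_prefix xb (ig n).
  by rewrite /E; ring.
have lim0 : K * \int[mu]_(t in `[a, b]) `|v t - g n t| @[n --> \oo] --> K * 0.
  apply: cvgMr; move/fine_cvgP : g0 => [_]; apply: cvg_trans.
  by apply: near_eq_cvg; near=> n.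
apply/eqP; rewrite -normr_le0 -(mulr0 K).
by rewrite -(cvg_lim _ lim0)//; apply: limr_ge; [exact: cvgP lim0|near=> n].
Unshelve. all: by end_near. Qed.

End IntegrationByParts.

(** * Trigonometric polynomials *)

Section Trig.
Variable R : realType.

(** The test functions: the linear span of the cos (k x) and sin (k x).  Unlike the
    algebra generated by cos and sin, to which it is equal, this presentation makes
    primitives visible; stability under products is recovered by
    trig_mul_cos and trig_mul_sin. *)
Inductive trig : (R -> R) -> Prop :=
| trig_cos k : trig (fun x => cos (k%:R * x))
| trig_sin k : trig (fun x => sin (k%:R * x))
| trigD f g : trig f -> trig g -> trig (fun x => f x + g x)
| trigZ c f : trig f -> trig (fun x => c * f x).

Lemma trig_ext (f g : R -> R) : f =1 g -> trig f -> trig g.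
Proof. by move=> /funext ->. Qed.

Lemma trig_cst c : trig (fun=> c).
Proof.
apply: trig_ext (trigZ c (trig_cos 0)) => x /=.
by rewrite mul0r cos0 mulr1.
Qed.

Lemma is_derive_cosM (k : nat) (x : R) :
  is_derive x 1 (fun x => cos (k%:R * x)) (- k%:R * sin (k%:R * x)).
Proof. by apply: is_derive_eq; rewrite !scaler1/= /GRing.scale/=; ring. Qed.

Lemma is_derive_sinM (k : nat) (x : R) :
  is_derive x 1 (fun x => sin (k%:R * x)) (k%:R * cos (k%:R * x)).
Proof. by apply: is_derive_eq; rewrite !scaler1/= /GRing.scale/=; ring. Qed.

Lemma is_deriveDfun (f g : R -> R) (df dg x : R) : is_derive x 1 f df ->
  is_derive x 1 g dg -> is_derive x 1 (fun x => f x + g x) (df + dg).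
Proof. by move=> ? ?; apply: is_deriveD. Qed.

Lemma is_deriveZfun c (f : R -> R) (df x : R) : is_derive x 1 f df ->
  is_derive x 1 (fun x => c * f x) (c * df).
Proof. by move=> ?; apply: is_deriveZ. Qed.

Lemma trig_derive f : trig f ->
  exists2 df, trig df & forall x : R, is_derive x 1 f (df x).
Proof.
elim=> {f} [k|k|f g _ [df tdf Df] _ [dg tdg Dg]|c f _ [df tdf Df]].
- exists (fun x => - k%:R * sin (k%:R * x)); last exact: is_derive_cosM.
  exact: trigZ (trig_sin k).
- exists (fun x => k%:R * cos (k%:R * x)); last exact: is_derive_sinM.
  exact: trigZ (trig_cos k).
- exists (fun x => df x + dg x); first exact: trigD.
  by move=> x; exact: is_deriveDfun.
- exists (fun x => c * df x); first exact: trigZ.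
  by move=> x; exact: is_deriveZfun.
Qed.

Lemma trig_continuous f : trig f -> continuous f.
Proof.
move=> /trig_derive[df _ Df] x.
by apply/differentiable_continuous/derivable1_diffP; apply: ex_derive.
Qed.

Lemma trig_periodic f : trig f -> periodic f (2 * pi).
Proof.
elim=> {f} [k|k|f g _ Pf _ Pg|c f _ Pf] x; rewrite ?Pf ?Pg//.
- rewrite -(periodicn (@cosD2pi R) k (k%:R * x)); congr cos.
  by rewrite -(mulr_natl (_ *+ _)) -(mulr_natl pi 2) mulrDr.
- rewrite -(periodicn (@sinD2pi R) k (k%:R * x)); congr sin.
  by rewrite -(mulr_natl (_ *+ _)) -(mulr_natl pi 2) mulrDr.
Qed.

Lemma derive1_fun (f df : R -> R) : (forall x : R, is_derive x 1 f (df x)) ->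
  derive1 f = df.
Proof. by move=> Df; apply/funext => x; rewrite derive1E; apply: derive_val. Qed.

Lemma trig_derive1n n f : trig f -> trig (derive1n n f).
Proof.
move=> tf; elim: n => // n /trig_derive[df tdf Df].
by rewrite derive1nS (derive1_fun Df).
Qed.

Lemma trig_test f : trig f -> torus_test f.
Proof.
move=> tf; split; first exact: trig_periodic.
move=> n x; have [df _ Df] := trig_derive (trig_derive1n n tf).
exact: ex_derive.
Qed.

(** Up to the additive constant c, the mean value of f, every trigonometric
    polynomial is a derivative, hence also a second derivative. *)
Lemma trig_primitive f : trig f ->
  exists c, exists2 F, trig F & forall x : R, is_derive x 1 F (f x - c).
Proof.
elim=> {f} [[|k]|[|k]|f g _ [c [F tF DF]] _ [d [G tG DG]]|e f _ [c [F tF DF]]].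
- exists 1, (fun=> 0); first exact: trig_cst.
  by move=> x; rewrite mul0r cos0 subrr; exact: is_derive_cst.
- exists 0, (fun x => k.+1%:R^-1 * sin (k.+1%:R * x)); first exact: trigZ (trig_sin _).
  move=> x; rewrite subr0; have := is_deriveZfun k.+1%:R^-1 (is_derive_sinM k.+1 x).
  by rewrite mulrA mulVf ?mul1r// pnatr_eq0.
- exists 0, (fun=> 0); first exact: trig_cst.
  by move=> x; rewrite mul0r sin0 subrr; exact: is_derive_cst.
- exists 0, (fun x => - k.+1%:R^-1 * cos (k.+1%:R * x)); first exact: trigZ (trig_cos _).
  move=> x; rewrite subr0; have := is_deriveZfun (- k.+1%:R^-1) (is_derive_cosM k.+1 x).
  by rewrite mulrA mulrNN mulVf ?mul1r// pnatr_eq0.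
- exists (c + d), (fun x => F x + G x); first exact: trigD.
  by move=> x; rewrite opprD addrACA; exact: is_deriveDfun.
- exists (e * c), (fun x => e * F x); first exact: trigZ.
  by move=> x; rewrite -mulrBr; exact: is_deriveZfun.
Qed.

Lemma natrMB1 (k : nat) (x : R) : k%:R * x = k.+1%:R * x - x.
Proof. by rewrite -natr1 mulrDl mul1r addrK. Qed.

Lemma natrMD1 (k : nat) (x : R) : k.+1%:R * x = k%:R * x + x.
Proof. by rewrite -natr1 mulrDl mul1r. Qed.

Lemma trig_mul_cos f : trig f -> trig (fun x => f x * cos x).
Proof.
elim=> {f} [[|k]|[|k]|f g _ tf _ tg|c f _ tf].
- by apply: trig_ext (trig_cos 1) => x; rewrite mul0r cos0 !mul1r.
- apply: trig_ext (trigZ 2^-1 (trigD (trig_cos k) (trig_cos k.+2))) => x.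
  rewrite (natrMB1 k) (natrMD1 k.+1).
  by rewrite cosB cosD; field.
- by apply: trig_ext (trig_cst 0) => x; rewrite mul0r sin0 mul0r.
- apply: trig_ext (trigZ 2^-1 (trigD (trig_sin k) (trig_sin k.+2))) => x.
  rewrite (natrMB1 k) (natrMD1 k.+1).
  by rewrite sinB sinD; field.
- by apply: trig_ext (trigD tf tg) => x; ring.
- by apply: trig_ext (trigZ c tf) => x; ring.
Qed.

Lemma trig_mul_sin f : trig f -> trig (fun x => f x * sin x).
Proof.
elim=> {f} [[|k]|[|k]|f g _ tf _ tg|c f _ tf].
- by apply: trig_ext (trig_sin 1) => x; rewrite mul0r cos0 !mul1r.
- apply: trig_ext (trigZ 2^-1 (trigD (trigZ (-1) (trig_sin k)) (trig_sin k.+2))) => x.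
  rewrite (natrMB1 k) (natrMD1 k.+1).
  by rewrite sinB sinD; field.
- by apply: trig_ext (trig_cst 0) => x; rewrite mul0r sin0 mul0r.
- apply: trig_ext (trigZ 2^-1 (trigD (trig_cos k) (trigZ (-1) (trig_cos k.+2)))) => x.
  rewrite (natrMB1 k) (natrMD1 k.+1).
  by rewrite cosB cosD; field.
- by apply: trig_ext (trigD tf tg) => x; ring.
- by apply: trig_ext (trigZ c tf) => x; ring.
Qed.

(** On a period, this trigonometric polynomial exceeds 1 at distance less than h from
    m and has absolute value at most 1 elsewhere, so that its powers concentrate
    around m. *)
Definition bump (h m x : R) : R := 1 - cos h + cos (x - m).

Lemma trig_bumpX h m n : trig (fun x => bump h m x ^+ n).
Proof.
elim: n => [|n IH]; first exact: trig_cst.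
apply: trig_ext (trigD (trigZ (1 - cos h) IH) (trigD (trigZ (cos m) (trig_mul_cos IH))
  (trigZ (sin m) (trig_mul_sin IH)))) => x.
by rewrite exprS /bump cosB; ring.
Qed.

End Trig.

(** * Completeness of the trigonometric polynomials *)

Section Complete.
Variable R : realType.
Notation mu := (@lebesgue_measure R).
Notation J := `[0, 2 * pi]%classic.
Implicit Types (a b c d h m x : R).

Lemma linear_le_expr x n : 1 <= x -> n%:R * (x - 1) <= x ^+ n.
Proof.
move=> x1; elim: n => [|n IH]; first by rewrite mul0r expr0.
have E1 : 1 <= x ^+ n by exact: exprn_ege1.
rewrite exprS -natr1 mulrDl mul1r.
have : 0 <= (x - 1) * (x ^+ n - 1) by rewrite mulr_ge0 ?subr_ge0.
by move: IH; nra.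
Qed.

Lemma expr_unbounded x a c : 1 < x -> 0 < a -> exists n, c < a * x ^+ n.
Proof.
move=> x1 a0; set y := c / (a * (x - 1)).
have d0 : 0 < a * (x - 1) by rewrite mulr_gt0// subr_gt0.
exists (Num.Def.trunc y).+1.
apply: (@lt_le_trans _ _ (a * ((Num.Def.trunc y).+1%:R * (x - 1)))).
  by rewrite mulrCA -ltr_pdivrMr// truncnS_gt.
by rewrite ler_wpM2l ?(ltW a0)// linear_le_expr// ltW.
Qed.

Lemma bump_near_ge h x : 0 < h -> h <= pi -> `|x| <= h / 2 ->
  1 + cos (h / 2) - cos h <= 1 - cos h + cos x.
Proof.
move=> h0 hpi xh; have := xh; rewrite -(cos_norm x) => xh'.
suff : cos (h / 2) <= cos `|x| by move: (cos _) (cos _) => ? ?; lra.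
have : `|x| \in `[0, pi] by rewrite in_itv/= normr_ge0/=; lra.
have h2 : h / 2 \in `[0, pi] by rewrite in_itv/=; lra.
by move=> xp; rewrite leNgt ltr_cos// -leNgt.
Qed.

Lemma bump_ge1 h x : 0 < h -> h <= pi -> `|x| < h -> 1 <= 1 - cos h + cos x.
Proof.
move=> h0 hpi xh; rewrite -(cos_norm x).
suff : cos h <= cos `|x| by move: (cos _) (cos _) => ? ?; lra.
have xp : `|x| \in `[0, pi] by rewrite in_itv/= normr_ge0/=; lra.
have h2 : h \in `[0, pi] by rewrite in_itv/=; lra.
by rewrite leNgt ltr_cos// -leNgt ltW.
Qed.

Lemma bump_norm_le1 h x : 0 < h -> h <= pi -> h <= `|x| -> `|x| <= 2 * pi - h ->
  `|1 - cos h + cos x| <= 1.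
Proof.
move=> h0 hpi hx xh; rewrite -(cos_norm x).
have h2 : h \in `[0, pi] by rewrite in_itv/=; lra.
have : cos `|x| <= cos h.
  have [xpi|pix] := leP `|x| pi.
    have xp : `|x| \in `[0, pi] by rewrite in_itv/= normr_ge0/=.
    by rewrite leNgt ltr_cos// -leNgt.
  rewrite (_ : cos `|x| = cos (2 * pi - `|x|)); last first.
    by rewrite -(cosN (_ - _)) opprB -(cosD2pi (_ - _)) mulr_natl subrK.
  have xp : 2 * pi - `|x| \in `[0, pi] by rewrite in_itv/=; lra.
  by rewrite leNgt ltr_cos// -leNgt; lra.
have := cos_geN1 `|x|; have := cos_le1 h; rewrite ler_norml.
by move: (cos _) (cos _) => ? ? *; apply/andP; split; lra.
Qed.

Lemma Rintegral_subset_ge0 a b c d (F : R -> R) : a <= c -> d <= b ->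
  mu.-integrable `[a, b] (EFin \o F) -> (forall x, a <= x <= b -> 0 <= F x) ->
  \int[mu]_(x in `[c, d]) F x <= \int[mu]_(x in `[a, b]) F x.
Proof.
move=> ac db iF F0.
have sub : `[c, d] `<=` `[a, b] by apply: subset_itv; rewrite bnd_simp.
rewrite /Rintegral fine_le//.
- by apply: integrable_fin_num => //; apply: integrableS iF.
- exact: integrable_fin_num.
- apply: ge0_subset_integral => //=.
  by case/integrableP : iF.
Qed.

(** If H m > 0, pairing H with the n-th power of bump h m gives at least a constant
    times q ^ n, with q > 1, from the neighbourhood of m, and at least minus the
    L^1-norm of H from the rest of the period: such a sum cannot vanish for all n. *)
Lemma trig_orthogonal_le0 (H : R -> R) m : {within J, continuous H} ->
  (forall t, trig t -> \int[mu]_(x in J) (t x * H x) = 0) ->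
  0 < m < 2 * pi -> H m <= 0.
Proof.
move=> cH tH /andP[m0 m2]; rewrite leNgt; apply/negP => Hm.
have pi20 : 0 < 2 * pi :> R by rewrite mulr_gt0// pi_gt0.
have /(continuous_within_itvP _ pi20)[cHo _ _] := cH.
have : H x @[x --> m] --> H m by apply: cHo; rewrite in_itv/= m0.
move=> /cvgrPdist_lt/(_ (H m / 2)); rewrite divr_gt0// => /(_ isT).
move=> [e /= e0 He].
set h := Num.min e (Num.min m (2 * pi - m)).
have h0 : 0 < h by rewrite !lt_min e0 m0 subr_gt0.
have he : h <= e by rewrite ge_min lexx.
have hm : h <= m by rewrite !ge_min lexx orbT.
have hm2 : h <= 2 * pi - m by rewrite !ge_min lexx !orbT.
have hpi : h <= pi by lra.
have HH x : `|x - m| < h -> H m / 2 < H x.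
  move=> xm; have /= := He x; rewrite distrC => /(_ (lt_le_trans xm he)).
  by rewrite ltr_distlC => /andP[]; lra.
have q1 : 1 < 1 + cos (h / 2) - cos h.
  have : cos h < cos (h / 2) by rewrite ltr_cos ?in_itv/=; lra.
  by move: (cos _) (cos _) => ? ?; lra.
have a0 : 0 < H m / 2 * h by rewrite mulr_gt0// divr_gt0.
have iH := within_continuous_integrable cH.
have iaH : mu.-integrable J (EFin \o (fun x => `|H x|)) by move: iH => /integrable_norm.
have [n] := expr_unbounded (\int[mu]_(x in J) `|H x|) q1 a0.
apply/negP; rewrite -leNgt.
have tq := @trig_bumpX R h m n.
have iq : mu.-integrable J (EFin \o (fun x => bump h m x ^+ n * H x)).
  apply: within_continuous_integrableM => //.
  by apply: continuous_subspaceT; exact: trig_continuous.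
(* The negative part of the integrand is at most |H|, wherever it occurs. *)
have Phi0 x : 0 <= x <= 2 * pi -> 0 <= bump h m x ^+ n * H x + `|H x|.
  move=> /andP[x0 x2]; have [xh|hx] := ltP `|x - m| h.
    rewrite addr_ge0// mulr_ge0//.
      by rewrite exprn_ge0// (le_trans ler01)// bump_ge1.
    by rewrite (le_trans _ (ltW (HH x xh)))// ltW// divr_gt0.
  have : `|x - m| <= 2 * pi - h by rewrite ler_norml; lra.
  move=> /(bump_norm_le1 h0 hpi hx) B1.
  rewrite -lerBlDr sub0r lerNl -mulNr (le_trans (ler_norm _))//.
  by rewrite normrM normrN normrX ler_piMl// exprn_ile1.
have iPhi : mu.-integrable J (EFin \o (fun x => bump h m x ^+ n * H x + `|H x|)).
  rewrite (_ : _ \o _ = fun x =>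
    (bump h m x ^+ n * H x)%:E + (`|H x|)%:E)%E; last by apply/funext => x /=; rewrite EFinD.
  exact: (integrableD _ iq iaH).
have -> : \int[mu]_(x in J) `|H x| = \int[mu]_(x in J) (bump h m x ^+ n * H x + `|H x|).
  by rewrite RintegralD// (tH _ tq) add0r.
have sub : `[m - h / 2, m + h / 2] `<=` J.
  by apply: subset_itv; rewrite bnd_simp; lra.
apply: le_trans (Rintegral_subset_ge0 (c := m - h / 2) (d := m + h / 2) _ _ iPhi Phi0); [|lra..].
rewrite (_ : _ * _ = H m / 2 * (1 + cos (h / 2) - cos h) ^+ n
    * (m + h / 2 - (m - h / 2))); last first.
  by move: (_ ^+ n) => z; field.
rewrite -Rintegral_itv_cst; last lra.
apply: le_Rintegral => //.
- by apply: within_continuous_integrable => x; exact: cst_continuous.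
- by apply: integrableS iPhi.
- move=> x /=; rewrite in_itv/= => xm.
  have xm2 : `|x - m| <= h / 2 by rewrite ler_norml; lra.
  rewrite mulrC -[leLHS]addr0 lerD// ler_pM//.
  + by rewrite exprn_ge0//; lra.
  + by rewrite ltW// divr_gt0.
  + have B := bump_near_ge h0 hpi xm2.
    rewrite lerXn2r ?nnegrE//; first lra.
    by apply: le_trans B; lra.
  + by rewrite ltW// HH//; lra.
Qed.

End Complete.

(** * Functions whose second weak derivative is zero *)

Section Weyl.
Variable R : realType.
Notation mu := (@lebesgue_measure R).
Notation J := `[0, 2 * pi]%classic.
Implicit Types (a b c d h m x : R) (u v w : R -> R).

Lemma pi2_gt0 : 0 < 2 * pi :> R.
Proof. by rewrite mulr_gt0// pi_gt0. Qed.

Lemma trig_orthogonal_eq0 (H : R -> R) x : {within J, continuous H} ->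
  (forall t, trig t -> \int[mu]_(x in J) (t x * H x) = 0) ->
  0 < x < 2 * pi -> H x = 0.
Proof.
move=> cH tH x02; apply/eqP; rewrite eq_le (trig_orthogonal_le0 cH tH x02)/=.
rewrite -oppr_le0; apply: (@trig_orthogonal_le0 R (fun x => - H x)) => //.
  by move=> y; apply: continuousN; exact: cH.
move=> t tt; rewrite (_ : \int[mu]_(y in J) _ = \int[mu]_(y in J) (-1 * (t y * H y))).
  rewrite RintegralZl ?tH ?mulr0//.
  apply: within_continuous_integrableM; last exact: within_continuous_integrable.
  by apply: continuous_subspaceT; exact: trig_continuous.
by apply: eq_Rintegral => y _; ring.
Qed.

Definition mean w := (\int[mu]_(x in J) w x) / (2 * pi).

Lemma integrable_addc (a b c : R) w : mu.-integrable `[a, b] (EFin \o w) ->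
  mu.-integrable `[a, b] (EFin \o (fun x => w x + c)).
Proof.
move=> iw; rewrite (_ : _ \o _ = fun x => (w x)%:E + c%:E)%E//.
apply: (integrableD _ iw) => //.
by apply: within_continuous_integrable => x; exact: cst_continuous.
Qed.

Lemma integrable_cst (a b c : R) : mu.-integrable `[a, b] (EFin \o (fun=> c)).
Proof. by apply: within_continuous_integrable => x; exact: cst_continuous. Qed.

Lemma Rintegral_sub_mean w : mu.-integrable J (EFin \o w) ->
  \int[mu]_(x in J) (w x - mean w) = 0.
Proof.
move=> iw; rewrite RintegralD//; last exact: integrable_cst.
rewrite Rintegral_itv_cst ?subr0 ?(ltW pi2_gt0)// mulNr /mean divfK ?subrr//.
by rewrite gt_eqF// pi2_gt0.
Qed.

Lemma trig_integrableM t w : trig t -> mu.-integrable J (EFin \o w) ->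
  mu.-integrable J (EFin \o (fun x => t x * w x)).
Proof.
move=> tt; apply: within_continuous_integrableM.
by apply: continuous_subspaceT; exact: trig_continuous.
Qed.

Lemma trig_integrable t : trig t -> mu.-integrable J (EFin \o t).
Proof.
move=> tt; apply: within_continuous_integrable.
by apply: continuous_subspaceT; exact: trig_continuous.
Qed.

Lemma trig_Rintegral_derive F dF : trig F -> trig dF ->
  (forall x, is_derive x 1 F (dF x)) -> \int[mu]_(x in J) dF x = 0.
Proof.
move=> tF tdF DF; have cF := trig_continuous tF.
rewrite /Rintegral (@continuous_FTC2 R dF F)//.
- have /= := trig_periodic tF 0; rewrite add0r => ->.
  by rewrite /= subrr.
- exact: pi2_gt0.
- by apply: continuous_subspaceT; exact: trig_continuous.
- split; first by move=> x _; apply: ex_derive.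
  + by apply: cvg_at_right_filter; exact: cF.
  + by apply: cvg_at_left_filter; exact: cF.
- by move=> x _; rewrite derive1E; apply: derive_val.
Qed.

(** Derivatives of trigonometric polynomials are those of mean zero, so a function
    orthogonal to them becomes orthogonal to all trigonometric polynomials once its
    own mean is removed. *)
Lemma trig_orthogonal_sub_mean w : mu.-integrable J (EFin \o w) ->
  (forall F dF, trig F -> trig dF -> (forall x, is_derive x 1 F (dF x)) ->
    \int[mu]_(x in J) (dF x * w x) = 0) ->
  forall t, trig t -> \int[mu]_(x in J) (t x * (w x - mean w)) = 0.
Proof.
move=> iw w0 t tt; have [c [F tF DF]] := trig_primitive tt.
have tdF : trig (fun x => t x - c) by apply: trigD => //; exact: trig_cst.
have iw0 := integrable_addc (- mean w) iw.
have ih : mu.-integrable J (EFin \o (fun x => (t x - c) * w x)) by exact: trig_integrableM.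
rewrite (_ : \int[mu]_(x in J) _ = \int[mu]_(x in J)
   (((t x - c) * w x - mean w * (t x - c)) + c * (w x - mean w))); last first.
  by apply: eq_Rintegral => x _; ring.
have itc : mu.-integrable J (EFin \o (fun x => mean w * (t x - c))).
  by apply: trig_integrable; apply: trigZ.
have icw : mu.-integrable J (EFin \o (fun x => c * (w x - mean w))).
  by apply: trig_integrableM => //; exact: trig_cst.
rewrite RintegralD//; last first.
  rewrite (_ : _ \o _ = fun x => ((t x - c) * w x)%:E - (mean w * (t x - c))%:E)%E//.
  exact: (integrableB _ ih itc).
rewrite RintegralB// RintegralZl//; last exact: trig_integrable.
rewrite RintegralZl// Rintegral_sub_mean// (w0 _ _ tF tdF DF).
by rewrite (trig_Rintegral_derive tF tdF DF); ring.
Qed.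

(** The density argument requires continuity, which w lacks.  It is applied instead
    to the indefinite integral H of w - mean w: after integration by parts, H is
    orthogonal to all derivatives, hence constant, and w - mean w is almost
    everywhere the derivative of H. *)
Lemma weak_derivative2_eq0 w : mu.-integrable J (EFin \o w) ->
  (forall s, trig s -> \int[mu]_(x in J) (derive1n 2 s x * w x) = 0) ->
  {ae mu, forall x, 0 < x < 2 * pi -> w x = mean w}.
Proof.
move=> iw w0; pose h x := w x - mean w.
have ih : mu.-integrable J (EFin \o h) by exact: integrable_addc.
have h0 t : trig t -> \int[mu]_(x in J) (t x * h x) = 0.
  apply: trig_orthogonal_sub_mean => // F dF tF tdF DF.
  have [c [S tS DS]] := trig_primitive tF.
  rewrite -[RHS](w0 _ tS); apply: eq_Rintegral => x _; congr (_ * _).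
  rewrite derive1nS derive1n1 (derive1_fun DS) derive1E.
  have : is_derive x 1 (fun x => F x - c) (dF x + 0) by exact: is_deriveDfun.
  by move=> D; rewrite (derive_val (df := dF x + 0)) addr0.
pose H x := \int[mu]_(t in `[0, x]) h t.
have cH : {within J, continuous H} := Rintegral_continuous (ltW pi2_gt0) ih.
have H2 : H (2 * pi) = 0 by exact: Rintegral_sub_mean.
have Hc x : 0 < x < 2 * pi -> H x = mean H.
  move=> x02; apply/eqP; rewrite -subr_eq0; apply/eqP.
  apply: (@trig_orthogonal_eq0 (fun x => H x - mean H)) => //.
    by move=> y; apply: continuousB; [exact: cH|exact: cst_continuous].
  apply: trig_orthogonal_sub_mean; first exact: within_continuous_integrable.
  move=> F dF tF tdF DF.
  have := integrable_ibp pi2_gt0 DF (trig_continuous tdF) ih.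
  rewrite (h0 _ tF) -/(H _) H2 mulr0 sub0r.
  by move/esym/eqP; rewrite oppr_eq0 => /eqP.
pose hJ := h \_ J.
have ihJ : mu.-integrable setT (EFin \o hJ).
  by rewrite -restrict_EFin; apply/integrable_restrict => //=; rewrite setTI.
have ihy y : mu.-integrable [set` Interval (BLeft 0) (BRight y)] (EFin \o hJ).
  exact: integrableS ihJ.
have loc : locally_integrable [set: R] hJ by exact: integrable_locally.
have := FTC1 ihy loc; apply: filterS; first exact: (ae_filter_ringOfSetsType mu).
move=> x /= FTC /andP[x0 x2]; apply/eqP; rewrite -subr_eq0 -/(h x).
have [|_] := FTC; first by rewrite lte_fin.
have -> : hJ x = h x by rewrite /hJ patchE mem_set//= in_itv/= !ltW.
move=> <-; apply/eqP; rewrite derive1E.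
rewrite (near_eq_derive (g := cst (mean H))) ?derive_cst//.
near=> y; rewrite /= -(Hc y).
  apply: eq_Rintegral => t; rewrite inE/= in_itv/= => /andP[t0 ty].
  rewrite /hJ patchE mem_set//= in_itv/= t0/= (le_trans ty)// ltW//.
  by near: y; exact: lt_nbhsl.
by apply/andP; split; near: y; [exact: lt_nbhsr|exact: lt_nbhsl].
Unshelve. all: by end_near. Qed.

End Weyl.

(** * Primitives on one period *)

Section Primitive.
Variable R : realType.
Notation mu := (@lebesgue_measure R).
Notation T := (2 * pi : R).
Notation J := `[0, T]%classic.
Implicit Types (c k x y : R) (F G f g : R -> R).

(** The derivative is taken on the open interval: an indefinite integral over [0, x]
    is zero for x < 0, so that it has in general no derivative at 0. *)
Definition primitive F f := {within J, continuous F} /\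
  forall x, 0 < x < T -> is_derive x 1 F (f x).

Lemma primitive_eq F f g : primitive F f -> (forall x, 0 < x < T -> f x = g x) ->
  primitive F g.
Proof. by move=> [cF DF] fg; split=> // x x02; rewrite -fg//; exact: DF. Qed.

Lemma primitive_cst c : primitive (fun=> c) (fun=> 0).
Proof. by split=> [x|x _]; [exact: cst_continuous|exact: is_derive_cst]. Qed.

Lemma primitive_id : primitive (fun x => x) (fun=> 1).
Proof.
split=> [|x _]; last exact: is_derive_id.
by apply: continuous_subspaceT => x; exact: cvg_id.
Qed.

Lemma primitiveD F G f g : primitive F f -> primitive G g ->
  primitive (fun x => F x + G x) (fun x => f x + g x).
Proof.
move=> [cF DF] [cG DG]; split => [x|x x02].
  by apply: continuousD; [exact: cF|exact: cG].
by have := DF x x02; have := DG x x02 => ? ?; apply: is_deriveD.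
Qed.

Lemma primitiveN F f : primitive F f -> primitive (fun x => - F x) (fun x => - f x).
Proof.
move=> [cF DF]; split => [x|x x02].
  by apply: continuousN; exact: cF.
by have := DF x x02 => ?; apply: is_deriveN.
Qed.

Lemma primitiveM F G f g : primitive F f -> primitive G g ->
  primitive (fun x => F x * G x) (fun x => F x * g x + G x * f x).
Proof.
move=> [cF DF] [cG DG]; split => [x|x x02].
  by apply: continuousM; [exact: cF|exact: cG].
by have := DF x x02; have := DG x x02 => ? ?; apply: is_deriveM.
Qed.

Lemma primitiveZ c F f : primitive F f -> primitive (fun x => c * F x) (fun x => c * f x).
Proof.
move=> Ff; apply: primitive_eq (primitiveM (primitive_cst c) Ff) _.
by move=> x _; rewrite mulr0 addr0.
Qed.

Lemma primitive_mean_value F f : primitive F f ->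
  exists2 x, 0 < x < T & F T - F 0 = f x * T.
Proof.
move=> [cF DF].
have DF' x : x \in `]0, T[ -> is_derive x 1 F (f x) by rewrite in_itv/= => /DF.
have [c] := MVT (pi2_gt0 R) DF' cF.
by rewrite in_itv/= subr0; exists c.
Qed.

Lemma primitive_ge0_le F f : primitive F f -> (forall x, 0 < x < T -> 0 <= f x) ->
  forall x y, 0 <= x -> x <= y -> y <= T -> F x <= F y.
Proof.
move=> [cF DF] f0 x y x0 xy y2.
have /ger0_derive1_le_cc : forall x, x \in `]0, T[ -> derivable F x 1.
  by move=> z; rewrite in_itv/= => /DF Dz; exact: ex_derive.
apply => //; rewrite ?in_itv/=; last by lra.
  move=> z; rewrite in_itv/= => z02; have Dz := DF _ z02.
  by rewrite derive1E derive_val f0.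
by lra.
Qed.

(** F increases at rate at most k, and by periodicity each of the points x and x0 is
    reached from the other by moving to the right over a distance at most T. *)
Lemma primitive_periodic_norm_le F f k x0 x : primitive F f -> F 0 = F T ->
  (forall x, 0 < x < T -> f x <= k) -> 0 <= x0 <= T -> F x0 = 0 ->
  0 <= x <= T -> `|F x| <= T * k.
Proof.
move=> Ff F02 fk x0T Fx0 xT.
have k0 : 0 <= k.
  have [z z02] := primitive_mean_value Ff; rewrite F02 subrr => /esym/eqP.
  by rewrite mulf_eq0 (gt_eqF (pi2_gt0 R)) orbF => /eqP <-; exact: fk.
have mono : forall x y, 0 <= x -> x <= y -> y <= T -> k * x - F x <= k * y - F y.
  apply: primitive_ge0_le (primitiveD (primitiveZ k primitive_id) (primitiveN Ff)) _.
  by move=> z z02; rewrite mulr1 subr_ge0 fk.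
have T0 := pi2_gt0 R.
have := mono 0 x; have := mono x T; have := mono 0 x0; have := mono x0 T.
rewrite ler_norml -F02 Fx0.
have [xx0|x0x] := leP x x0.
  have := mono x x0; rewrite Fx0.
  move=> m1 m2 m3 m4 m5; apply/andP; split; first nra.
  by have := m2; nra.
have := mono x0 x; rewrite Fx0.
by move=> m1 m2 m3 m4 m5; apply/andP; split; nra.
Qed.

Lemma primitive_le0_eq0 F f : primitive F f -> F 0 = F T ->
  (forall x, 0 < x < T -> f x <= 0) -> forall x, 0 < x < T -> f x = 0.
Proof.
move=> Ff F02 f0 x x02.
have NF : forall x y, 0 <= x -> x <= y -> y <= T -> - F x <= - F y.
  by apply: primitive_ge0_le (primitiveN Ff) _ => z /f0; rewrite oppr_ge0.
have Fc y : 0 < y < T -> F y = F 0.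
  move=> /andP[y0 yT]; apply/eqP; rewrite eq_le.
  have := NF 0 y (lexx _) (ltW y0) (ltW yT).
  have := NF y T (ltW y0) (ltW yT) (lexx _).
  by rewrite -F02 !lerN2 => -> ->.
have Dx := Ff.2 _ x02.
rewrite -(derive_val (f := F) (df := f x) (a := x) (v := 1)).
rewrite (near_eq_derive (g := cst (F 0))) ?derive_cst//.
move: x02 => /andP[x0 xT]; near=> y; rewrite Fc//.
by apply/andP; split; near: y; [exact: lt_nbhsr|exact: lt_nbhsl].
Unshelve. all: by end_near. Qed.

Lemma primitive_eq0_cst F f : primitive F f -> (forall x, 0 < x < T -> f x = 0) ->
  forall x, 0 <= x <= T -> F x = F 0.
Proof.
move=> Ff f0 x /andP[x0 xT]; apply/eqP; rewrite eq_le.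
rewrite -lerN2 (primitive_ge0_le (primitiveN Ff))//=.
  by rewrite (primitive_ge0_le Ff)// => z /f0 ->.
by move=> z /f0 ->; rewrite oppr0.
Qed.

Lemma primitive_Rintegral f : {within J, continuous f} ->
  primitive (fun x => \int[mu]_(t in `[0, x]) f t) f.
Proof.
move=> cf; have i := within_continuous_integrable cf; split.
  exact: Rintegral_continuous (ltW (pi2_gt0 R)) i.
move=> x /andP[x0 xT].
have /(continuous_within_itvP _ (pi2_gt0 R))[cfo _ _] := cf.
have [|D E] := @continuous_FTC1_closed R f 0 x T xT i x0.
  by apply: cfo; rewrite in_itv/= x0.
by apply: DeriveDef => //; rewrite -derive1E.
Qed.

End Primitive.

(** * Classical solutions *)

Section Nonlinearity.
Context {R : realType}.
Notation T := (2 * pi : R).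
Implicit Types b c : R -> R.

Definition sqmod b c x := b x ^+ 2 + c x ^+ 2.

(** lle_re + i lle_im is the value that the equation assigns to d a'', where
    a = b + i c. *)
Definition lle_re (zeta kappa : R) b c x : R :=
  c x + zeta * b x - sqmod b c x * b x + kappa * (sqmod b c x * c x).

Definition lle_im (zeta kappa f : R) b c x : R :=
  - b x + zeta * c x - sqmod b c x * c x - kappa * (sqmod b c x * b x) + f.

Context (zeta kappa f : R) (b c b1 c1 : R -> R).
Hypothesis Pb : primitive b b1.
Hypothesis Pc : primitive c c1.
Let r := sqmod b c.
Let p x := b x * b1 x + c x * c1 x.

Lemma primitive_sqmod : primitive r (fun x => 2 * p x).
Proof.
rewrite (_ : r = fun x => b x * b x + c x * c x).
  by apply: primitive_eq (primitiveD (primitiveM Pb Pb) (primitiveM Pc Pc)) _ => x _;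
    rewrite /p; ring.
by apply/funext => x; rewrite /r /sqmod; ring.
Qed.

Lemma primitive_lle_re : primitive (lle_re zeta kappa b c) (fun x => c1 x + zeta * b1 x
   - (2 * p x * b x + r x * b1 x) + kappa * (2 * p x * c x + r x * c1 x)).
Proof.
have Pr := primitive_sqmod.
apply: primitive_eq (primitiveD (primitiveD (primitiveD Pc
  (primitiveZ zeta Pb)) (primitiveN (primitiveM Pr Pb)))
  (primitiveZ kappa (primitiveM Pr Pc))) _ => x _.
by rewrite /r /p; ring.
Qed.

Lemma primitive_lle_im : primitive (lle_im zeta kappa f b c) (fun x => - b1 x + zeta * c1 x
   - (2 * p x * c x + r x * c1 x) - kappa * (2 * p x * b x + r x * b1 x)).
Proof.
have Pr := primitive_sqmod.
apply: primitive_eq (primitiveD (primitiveD (primitiveD (primitiveD (primitiveN Pb)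
  (primitiveZ zeta Pc)) (primitiveN (primitiveM Pr Pc)))
  (primitiveN (primitiveZ kappa (primitiveM Pr Pb)))) (primitive_cst f)) _ => x _.
by rewrite /r /p; ring.
Qed.

End Nonlinearity.

Section Classical.
Context {R : realType} (d zeta kappa f : R) (b c b1 c1 : R -> R).
Notation mu := (@lebesgue_measure R).
Notation T := (2 * pi : R).

Hypothesis d0 : d != 0.
Hypothesis k0 : 0 < kappa.
Hypothesis Pb : primitive b b1.
Hypothesis Pc : primitive c c1.
Hypothesis Pb1 : primitive b1 (fun x => lle_re zeta kappa b c x / d).
Hypothesis Pc1 : primitive c1 (fun x => lle_im zeta kappa f b c x / d).
Hypothesis b02 : b 0 = b T.
Hypothesis c02 : c 0 = c T.
Hypothesis b102 : b1 0 = b1 T.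
Hypothesis c102 : c1 0 = c1 T.

Let r := sqmod b c.
Let q := sqmod b1 c1.
Let g x := b x * c1 x - c x * b1 x.
Let p x := b x * b1 x + c x * c1 x.

Ltac expand := rewrite /q /g /p /r /lle_re /lle_im /r /sqmod.

(** The imaginary part of the equation times conj(a). *)
Let Pg : primitive (fun x => d * g x) (fun x => - r x - kappa * r x ^+ 2 + f * b x).
Proof.
apply: primitive_eq (primitiveZ d (primitiveD (primitiveM Pb Pc1)
  (primitiveN (primitiveM Pc Pb1)))) _ => x _.
by expand; field.
Qed.

Let Pr : primitive r (fun x => 2 * p x). Proof. exact: primitive_sqmod. Qed.

Let Pq : primitive q (fun x => 2 * (b1 x * (lle_re zeta kappa b c x / d) +
   c1 x * (lle_im zeta kappa f b c x / d))).
Proof.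
rewrite (_ : q = fun x => b1 x * b1 x + c1 x * c1 x); last first.
  by apply/funext => x; expand; ring.
apply: primitive_eq (primitiveD (primitiveM Pb1 Pb1) (primitiveM Pc1 Pc1)) _ => x _.
by rewrite /=; ring.
Qed.

(** The energy in the proof is the real part of the equation times conj(a'); its
    derivative is a negative multiple of g. *)
Let g_zero : exists2 x, 0 < x < T & g x = 0.
Proof.
have P := primitiveD (primitiveD (primitiveZ (d / 2) Pq) (primitiveZ (- zeta / 2) Pr))
  (primitiveD (primitiveZ 4^-1 (primitiveM Pr Pr)) (primitiveZ (- f) Pc)).
have [x x02 /esym/eqP] := primitive_mean_value P.
rewrite /q /r /sqmod b02 c02 b102 c102 subrr mulf_eq0 (gt_eqF (pi2_gt0 R)) orbF => /eqP E.
exists x => //; apply/eqP; have : (1 + kappa * r x) * g x = 0.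
  by rewrite -[RHS]oppr0 -[in RHS]E; expand; field.
move=> /eqP; rewrite mulf_eq0 => /orP[|//].
have r0 : 0 <= r x by rewrite addr_ge0 ?sqr_ge0.
by rewrite gt_eqF// addrC ltr_wpDl// mulr_ge0// ltW.
Qed.

Let pi0 : 0 <= pi :> R. Proof. exact: pi_ge0. Qed.

Let g_bound x : 0 <= x <= T -> `|d * g x| <= pi * f ^+ 2 / 2.
Proof.
move=> xT; have [x0 /andP[x00 x0T] gx0] := g_zero.
rewrite (_ : _ / 2 = T * (f ^+ 2 / 4)); last by field.
apply: (primitive_periodic_norm_le Pg (x0 := x0)) => //.
- by rewrite /g b02 c02 b102 c102.
- move=> y _; have := sqr_ge0 (b y - f / 2); have := sqr_ge0 (c y).
  have : 0 <= kappa * r y ^+ 2 by rewrite mulr_ge0 ?sqr_ge0// ltW.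
  by expand; nra.
- by rewrite !ltW.
- by rewrite gx0 mulr0.
Qed.

Let Rr x := \int[mu]_(t in `[0, x]) r t.
Let Q x := \int[mu]_(t in `[0, x]) q t.
Let PR : primitive Rr r. Proof. exact: primitive_Rintegral Pr.1. Qed.
Let PQ : primitive Q q. Proof. exact: primitive_Rintegral Pq.1. Qed.
Let R0 : Rr 0 = 0. Proof. by rewrite /Rr set_itv1 Rintegral_set1. Qed.
Let Q0 : Q 0 = 0. Proof. by rewrite /Q set_itv1 Rintegral_set1. Qed.

Let T0 : 0 <= T. Proof. exact: ltW (pi2_gt0 R). Qed.

Let R_bound : Rr T <= T * f ^+ 2.
Proof.
have H := primitive_ge0_le (primitiveD (primitiveD (primitiveZ (f ^+ 2 / 2) (primitive_id R))
   (primitiveN Pg)) (primitiveZ (- 2^-1) PR)).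
have {H} : f ^+ 2 / 2 * 0 - d * g 0 + - 2^-1 * Rr 0 <=
    f ^+ 2 / 2 * T - d * g T + - 2^-1 * Rr T.
  apply: H => // x _; have := sqr_ge0 (b x - f); have := sqr_ge0 (c x).
  have : 0 <= kappa * r x ^+ 2 by rewrite mulr_ge0 ?sqr_ge0// ltW.
  by expand; nra.
by rewrite R0 /g b02 c02 b102 c102; lra.
Qed.

Let Psi x := lle_im zeta kappa f b c x * b1 x - lle_re zeta kappa b c x * c1 x.

(** Psi is d Im(a'' conj(a')).  In its derivative the term Im(a'' conj(a'')) is zero,
    which leaves Im((d a'')' conj(a')), where only derivatives of the first order
    remain. *)
Let PPsi : primitive Psi (fun x => - q x + 2 * p x * g x - kappa * (3 * p x ^+ 2 + g x ^+ 2)).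
Proof.
have Pim := primitive_lle_im zeta kappa f Pb Pc.
have Pre := primitive_lle_re zeta kappa Pb Pc.
apply: primitive_eq (primitiveD (primitiveM Pim Pb1) (primitiveN (primitiveM Pre Pc1))) _ => x _.
by expand; field.
Qed.

Let Psi02 : Psi 0 = Psi T.
Proof. by rewrite /Psi /lle_im /lle_re /sqmod b02 c02 b102 c102. Qed.

Let pg_normE x : p x ^+ 2 + g x ^+ 2 = r x * q x.
Proof. by expand; ring. Qed.

Let q_eq0_cst : (forall x, 0 < x < T -> q x = 0) ->
  forall x, 0 <= x <= T -> b x = b 0 /\ c x = c 0.
Proof.
move=> q0 x xT.
have z (y : R) : 0 < y < T -> b1 y = 0 /\ c1 y = 0.
  move=> /q0 /eqP; rewrite paddr_eq0 ?sqr_ge0// !sqrf_eq0 => /andP[/eqP -> /eqP ->] //.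
by split; [apply: (primitive_eq0_cst Pb) => // y /z[]|apply: (primitive_eq0_cst Pc) => // y /z[]].
Qed.

(** Here Psi' <= - e q <= 0, and Psi is periodic: Psi' is zero, and so is q. *)
Let Psi_dissipative e : 0 < e ->
  (forall x, 0 < x < T -> 2 * p x * g x - kappa * (3 * p x ^+ 2 + g x ^+ 2) <= (1 - e) * q x) ->
  forall x, 0 <= x <= T -> b x = b 0 /\ c x = c 0.
Proof.
move=> e0 He; apply: q_eq0_cst => x x02.
have qx0 y : 0 <= q y by rewrite addr_ge0 ?sqr_ge0.
have D0 := primitive_le0_eq0 PPsi Psi02.
have := D0 _ _ x02 => /(_ _)/esym HD.
have hle y : 0 < y < T -> - q y + 2 * p y * g y - kappa * (3 * p y ^+ 2 + g y ^+ 2) <= - (e * q y).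
  by move=> /He; lra.
have := hle _ x02; rewrite -HD; last first.
  by move=> y /hle/le_trans; apply; rewrite oppr_le0 mulr_ge0// ltW.
move=> h; apply/eqP; rewrite eq_le qx0 andbT.
by rewrite -(pmulr_rle0 _ e0); lra.
Qed.

Let G := pi * f ^+ 2 / (2 * `|d|).

Let nd0 : 0 < `|d|. Proof. by rewrite normr_gt0. Qed.

Let g_le x : 0 <= x <= T -> `|g x| <= G.
Proof.
move=> /g_bound; rewrite normrM /G => h.
by rewrite ler_pdivlMr ?mulr_gt0//; lra.
Qed.

Let G_ge0 : 0 <= G.
Proof. by apply: divr_ge0; apply: mulr_ge0 => //; exact: sqr_ge0. Qed.

Let kpg_ge0 x : 0 <= kappa * (3 * p x ^+ 2 + g x ^+ 2).
Proof.
by apply: mulr_ge0; [exact: ltW|apply: addr_ge0; [apply: mulr_ge0 => //|]; exact: sqr_ge0].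
Qed.

Let young x : 0 < x < T -> 2 * p x * g x <= q x / 2 + 2 * G ^+ 2 * r x.
Proof.
move=> /andP[x0 xT]; have gx : `|g x| <= G by rewrite g_le// !ltW.
have g2 : g x ^+ 2 <= G ^+ 2 by rewrite -real_normK ?num_real// lerXn2r// nnegrE.
have r0 : 0 <= r x by rewrite addr_ge0 ?sqr_ge0.
(* Young's inequality 4 g p <= q + 4 g^2 r, as |a' - 2 g a|^2 >= 0. *)
have : 0 <= (b1 x - 2 * g x * b x) ^+ 2 + (c1 x - 2 * g x * c x) ^+ 2.
  by rewrite addr_ge0 ?sqr_ge0.
have -> : (b1 x - 2 * g x * b x) ^+ 2 + (c1 x - 2 * g x * c x) ^+ 2 =
  q x - 4 * g x * p x + 4 * g x ^+ 2 * r x by expand; ring.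
have := ler_wpM2r r0 g2.
by lra.
Qed.

Let Q_bound : Q T <= 4 * G ^+ 2 * (T * f ^+ 2).
Proof.
have H := primitive_ge0_le (primitiveD (primitiveN PPsi) (primitiveD (primitiveZ (- 2^-1) PQ)
   (primitiveZ (2 * G ^+ 2) PR))).
have {H} : - Psi 0 + (- 2^-1 * Q 0 + 2 * G ^+ 2 * Rr 0) <=
   - Psi T + (- 2^-1 * Q T + 2 * G ^+ 2 * Rr T).
  by apply: H => // x /young; have := kpg_ge0 x; lra.
rewrite Q0 R0 Psi02.
have := ler_wpM2l (sqr_ge0 G) R_bound; lra.
Qed.

(** The inequality |a' - 2 G a|^2 >= 0 (and its analogue with the sign +) compares
    2 G r' with 4 G^2 r + q, the integral of which is known. *)
Let r_bound x : 0 < G -> 0 <= x <= T -> r x <= f ^+ 2 + 4 * G * (T * f ^+ 2).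
Proof.
move=> G0 /andP[x0 xT].
have [x1 /andP[x10 x1T]] := primitive_mean_value PR.
rewrite R0 subr0 => R1.
have rx1 : r x1 <= f ^+ 2.
  by have := R_bound; rewrite R1 [leLHS]mulrC ler_pM2l ?pi2_gt0.
have Pm := primitiveD (primitiveD (primitiveZ (4 * G ^+ 2) PR) PQ) (primitiveZ (- (2 * G)) Pr).
have Pp := primitiveD (primitiveD (primitiveZ (4 * G ^+ 2) PR) PQ) (primitiveZ (2 * G) Pr).
have mm := primitive_ge0_le Pm.
have mp := primitive_ge0_le Pp.
have {}mm : forall x y, 0 <= x -> x <= y -> y <= T ->
   4 * G ^+ 2 * Rr x + Q x + - (2 * G) * r x <= 4 * G ^+ 2 * Rr y + Q y + - (2 * G) * r y.
  apply: mm => y _.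
  have -> : 4 * G ^+ 2 * r y + q y + - (2 * G) * (2 * p y) =
    (b1 y - 2 * G * b y) ^+ 2 + (c1 y - 2 * G * c y) ^+ 2 by expand; ring.
  by rewrite addr_ge0 ?sqr_ge0.
have {}mp : forall x y, 0 <= x -> x <= y -> y <= T ->
   4 * G ^+ 2 * Rr x + Q x + (2 * G) * r x <= 4 * G ^+ 2 * Rr y + Q y + (2 * G) * r y.
  apply: mp => y _.
  have -> : 4 * G ^+ 2 * r y + q y + (2 * G) * (2 * p y) =
    (b1 y + 2 * G * b y) ^+ 2 + (c1 y + 2 * G * c y) ^+ 2 by expand; ring.
  by rewrite addr_ge0 ?sqr_ge0.
have mR := primitive_ge0_le PR (fun x _ => addr_ge0 (sqr_ge0 (b x)) (sqr_ge0 (c x))).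
have mQ := primitive_ge0_le PQ (fun x _ => addr_ge0 (sqr_ge0 (b1 x)) (sqr_ge0 (c1 x))).
have G2 : 0 <= 4 * G ^+ 2 by rewrite mulr_ge0// sqr_ge0.
have Kt y z : 0 <= y -> y <= z -> z <= T ->
    4 * G ^+ 2 * Rr z + Q z - (4 * G ^+ 2 * Rr y + Q y) <= 8 * G ^+ 2 * (T * f ^+ 2).
  move=> y0 yz zT.
  have := mR z T (le_trans y0 yz) zT (lexx _); have := mR 0 y (lexx _) y0 (le_trans yz zT).
  have := mQ z T (le_trans y0 yz) zT (lexx _); have := mQ 0 y (lexx _) y0 (le_trans yz zT).
  rewrite R0 Q0 => h1 h2 h3 h4.
  have := ler_wpM2l G2 h4; have := ler_wpM2l G2 h3; have := ler_wpM2l G2 R_bound.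
  have := Q_bound; lra.
have : 2 * G * (r x - r x1) <= 2 * G * (4 * G * (T * f ^+ 2)).
  have [xx1|x1x] := leP x x1.
    by have := mp x x1 x0 xx1 (ltW x1T); have := Kt x x1 x0 xx1 (ltW x1T); lra.
  by have := mm x1 x (ltW x10) (ltW x1x) xT; have := Kt x1 x (ltW x10) (ltW x1x) xT; lra.
by rewrite ler_pM2l; [lra|exact: mulr_gt0].
Qed.

(** When kappa < 1, the hypothesis on kappa_star makes the a priori bound M on r
    smaller than 1, so that the forcing term 2 p g is absorbed by q; when
    kappa >= 1 the cubic term absorbs it alone.  If G = 0 then g = 0, and there
    is no forcing term. *)
Lemma lle_classical_constant : kappa_star d f < kappa ->
  forall x, 0 <= x <= T -> b x = b 0 /\ c x = c 0.
Proof.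
move=> kk; have [k1|k1] := leP 1 kappa.
  apply: (@Psi_dissipative 1) => // x _; rewrite subrr mul0r subr_le0.
  have : 0 <= (kappa - 1) * (p x ^+ 2 + g x ^+ 2) by rewrite mulr_ge0 ?subr_ge0 ?addr_ge0 ?sqr_ge0.
  have := sqr_ge0 (p x - g x); have : 0 <= kappa * p x ^+ 2 by rewrite mulr_ge0 ?sqr_ge0// ltW.
  by lra.
have [G0|] := ltP 0 G; last first.
  move=> Gle; apply: (@Psi_dissipative 1) => // x /andP[x0 xT]; rewrite subrr mul0r.
  have gx0 : g x = 0.
    by apply/eqP; rewrite -normr_le0 (le_trans (g_le _))// !ltW.
  by have := kpg_ge0 x; rewrite gx0 mulr0; lra.
set M := f ^+ 2 + 4 * G * (T * f ^+ 2).
have M1 : M < 1.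
  apply: le_lt_trans k1; apply: le_trans (ltW kk).
  set B := 1 + 2 * pi ^+ 2 * f ^+ 2 * `|d|^-1.
  have B1 : 1 <= B.
    rewrite lerDl; apply: mulr_ge0; last by rewrite invr_ge0.
    by apply: mulr_ge0; [apply: mulr_ge0 => //|]; exact: sqr_ge0.
  have -> : kappa_star d f = 6 * Num.sqrt 6 * B ^+ 3 * f ^+ 2 by [].
  have s6 : 1 <= Num.sqrt 6 :> R.
    by rewrite -[leLHS]sqrtr1 ler_sqrt//; lra.
  have B2 : B ^+ 2 <= B ^+ 3 by rewrite ler_weXn2l.
  (* M = (2 B - 1) f^2, and 2 B - 1 <= B^2. *)
  have MB : M <= B ^+ 2 * f ^+ 2.
    have -> : M = (1 + 2 * (B - 1)) * f ^+ 2.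
      by rewrite /M /B /G; field; rewrite gt_eqF.
    rewrite ler_wpM2r ?sqr_ge0//; have := sqr_ge0 (B - 1); lra.
  apply: (le_trans MB); rewrite ler_wpM2r ?sqr_ge0// (le_trans B2)//.
  rewrite ler_peMl// ?exprn_ge0//; first by lra.
  by lra.
apply: (@Psi_dissipative (1 - M)); first by rewrite subr_gt0.
move=> x /andP[x0 xT]; have rM : r x <= M by apply: r_bound => //; rewrite !ltW.
have qx0 : 0 <= q x by rewrite addr_ge0 ?sqr_ge0.
have := ler_wpM2r qx0 rM; rewrite -pg_normE.
by have := kpg_ge0 x; have := sqr_ge0 (p x - g x); lra.
Qed.

End Classical.

(** * Properties that hold almost everywhere *)

Section AE.
Variable R : realType.
Notation mu := (@lebesgue_measure R).

Lemma ae_filter : Filter (nbhs (almost_everywhere mu)).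
Proof. exact: (ae_filter_ringOfSetsType mu). Qed.

Lemma lebesgue_measure_shift (e : R) (A : set (measurableTypeR R)) : measurable A ->
  pushforward mu (+%R^~ e : _ -> measurableTypeR R) A = mu A.
Proof.
move=> mA; apply/esym/lebesgue_measure_unique => //.
  exact: (measurable_funD (@measurable_id _ _ _) (@measurable_cst _ _ _ _ _ _)).
move=> me /= _ [[a b]] _ <-.
rewrite /pushforward (_ : _ @^-1` _ = `]a - e, b - e]%classic); last first.
  by apply/seteqP; split => x /=; rewrite !in_itv/= ltrBlDr lerBrDr.
rewrite !lebesgue_measure_itv/= !lte_fin ltrD2r -!EFinD.
by rewrite (_ : b - e - (a - e) = b - a)//; ring.
Qed.

Lemma ae_shift (e : R) (P : R -> Prop) :
  {ae mu, forall x, P x} -> {ae mu, forall x, P (x + e)}.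
Proof.
move=> [A [mA A0 PA]]; exists (+%R^~ e @^-1` A); split.
- rewrite -[X in measurable X]setTI.
  exact: (measurable_funD (@measurable_id _ _ _) (@measurable_cst _ _ _ _ _ _)).
- by rewrite -[RHS]A0 -(lebesgue_measure_shift e mA).
- by move=> x /= nP; apply: PA.
Qed.

Lemma ae_neq (e : R) : {ae mu, forall x, x != e}.
Proof.
exists [set e]; split => //; first exact: lebesgue_measure_set1.
by move=> x /= /negP; rewrite negbK => /eqP.
Qed.

(** Up to the countable set of multiples of T, every point is the translate of a point
    of the open interval by a multiple of T. *)
Lemma ae_periodic (T : R) (P : R -> Prop) : 0 < T -> (forall x, P x <-> P (x + T)) ->
  {ae mu, forall x, 0 < x < T -> P x} -> {ae mu, forall x, P x}.
Proof.
move=> T0 PT P0.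
have Pn n x : P (x + T *+ n) <-> P x.
  by elim: n => [|n IH]; rewrite ?addr0// mulrSr addrA -PT.
have Pm n x : P (x - T *+ n) <-> P x by rewrite -(Pn n (x - T *+ n)) subrK.
have : {ae mu, forall x, forall n, (0 < x - T *+ n < T -> P (x - T *+ n)) /\
    (0 < x + T *+ n < T -> P (x + T *+ n)) /\ x != T *+ n /\ x != - (T *+ n)}.
  apply: ae_foralln => n.
  have H1 := ae_shift (- (T *+ n)) P0; have H2 := ae_shift (T *+ n) P0.
  have H3 := ae_neq (T *+ n); have H4 := ae_neq (- (T *+ n)).
  have F := ae_filter.
  by apply: filterS2 (filterI H1 H2) (filterI H3 H4) => x [? ?] [? ?].
apply: (@filterS _ _ ae_filter) => x Hx.
have /andP[f1 f2] := floor_itv (x / T).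
move: f1 f2; rewrite ler_pdivlMr// ltr_pdivrMr//.
case: (Num.floor _) => n /= f1 f2.
- have [h1 [_ [h3 _]]] := Hx n.
  apply/(Pm n)/h1; move: f1 f2 h3; rewrite intrD /= -(mulr_natl T).
  by rewrite mulrDl mul1r => f1 f2 h3; rewrite subr_gt0 lt_neqAle eq_sym h3 f1/=; lra.
- have [_ [h2 [_ h4]]] := Hx n.+1.
  apply/(Pn n.+1)/h2; move: f1 f2 h4; rewrite intrD NegzE mulrNz /= -(mulr_natl T).
  set y := n.+1%:R * T; rewrite mulrDl mul1r mulNr -/y => f1 f2 h4.
  have : x < - y \/ - y < x by move: h4; rewrite neq_lt => /orP[]; [left|right].
  lra.
Qed.

End AE.

(** * Gain of regularity *)

Section Regularity.
Context {R : realType}.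
Notation mu := (@lebesgue_measure R).
Notation T := (2 * pi : R).
Notation J := `[0, T]%classic.

(** The double primitive A of v, with the constants chosen so that A and its
    derivative are periodic, has weak second derivative v as well; hence u - A has
    weak second derivative zero and is constant. *)
Lemma weak_derivative2_primitive (u v : R -> R) :
  mu.-integrable J (EFin \o u) -> mu.-integrable J (EFin \o v) ->
  (forall s, trig s -> \int[mu]_(x in J) (derive1n 2 s x * u x) =
                       \int[mu]_(x in J) (s x * v x)) ->
  exists C D, let b1 x := C + \int[mu]_(t in `[0, x]) v t in
    let b x := D + \int[mu]_(t in `[0, x]) b1 t in
    [/\ \int[mu]_(x in J) v x = 0, \int[mu]_(x in J) b1 x = 0 &
     {ae mu, forall x, 0 < x < T -> u x = b x}].
Proof.
move=> iu iv uv.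
pose V x := \int[mu]_(t in `[0, x]) v t.
have T0 := ltW (pi2_gt0 R).
have cV : {within J, continuous V} := Rintegral_continuous T0 iv.
have iV := within_continuous_integrable cV.
have dc (k : R) : derive1 (fun=> k : R) = (fun=> 0) :> (R -> R).
  by apply: derive1_fun => x; exact: is_derive_cst.
(* The constant 1 is a test function with derivative zero. *)
have VT : V T = 0.
  have := uv _ (trig_cst 1); rewrite (_ : derive1n 2 _ = fun=> 0); last first.
    by rewrite derive1nS derive1n1 !dc.
  have -> : \int[mu]_(x in J) (0 * u x) = 0.
    rewrite -[RHS](mul0r (T - 0)) -Rintegral_itv_cst//.
    by apply: eq_Rintegral => x _; rewrite mul0r.
  by move=> v0; rewrite /V [RHS]v0; apply: eq_Rintegral => x _; rewrite mul1r.
pose B x := V x - mean V.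
have iB : mu.-integrable J (EFin \o B) by exact: integrable_addc.
have B0 : \int[mu]_(x in J) B x = 0 by exact: Rintegral_sub_mean.
pose A x := \int[mu]_(t in `[0, x]) B t.
have cA : {within J, continuous A} := Rintegral_continuous T0 iB.
have iA := within_continuous_integrable cA.
have iuA : mu.-integrable J (EFin \o (fun x => u x - A x)).
  rewrite (_ : _ \o _ = fun x => (u x)%:E - (A x)%:E)%E//.
  exact: (integrableB _ iu iA).
have orth s : trig s -> \int[mu]_(x in J) (derive1n 2 s x * (u x - A x)) = 0.
  move=> ts; have [s1 ts1 Ds] := trig_derive ts; have [s2 ts2 Ds1] := trig_derive ts1.
  have Es : derive1n 2 s = s2 by rewrite derive1nS derive1n1 (derive1_fun Ds) (derive1_fun Ds1).
  have := uv s ts; rewrite Es => us.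
  have I1 : \int[mu]_(x in J) (s x * v x) = - \int[mu]_(x in J) (s1 x * V x).
    rewrite (integrable_ibp (pi2_gt0 R) Ds (trig_continuous ts1) iv).
    by rewrite -/(V T) VT mulr0 sub0r.
  have I2 : \int[mu]_(x in J) (s2 x * A x) = - \int[mu]_(x in J) (s1 x * B x).
    rewrite (integrable_ibp (pi2_gt0 R) Ds1 (trig_continuous ts2) iB).
    by rewrite B0 mulr0 sub0r opprK.
  rewrite (_ : \int[mu]_(x in J) _ =
    \int[mu]_(x in J) (s2 x * u x - s2 x * A x)); last first.
    by apply: eq_Rintegral => x _; rewrite mulrBr.
  rewrite RintegralB//; [|exact: trig_integrableM..].
  rewrite us I1 I2 (_ : \int[mu]_(x in J) (s1 x * B x) =
     \int[mu]_(x in J) (s1 x * V x - mean V * s1 x)); last first.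
    by apply: eq_Rintegral => x _; rewrite /B; ring.
  rewrite RintegralB//; [|exact: trig_integrableM|exact: trig_integrable (trigZ _ ts1)].
  rewrite RintegralZl//; last exact: trig_integrable.
  by rewrite (trig_Rintegral_derive ts ts1 Ds) mulr0 subr0 subrr.
have := weak_derivative2_eq0 iuA orth; set D := mean _ => ae.
exists (- mean V), D; split => //.
  by rewrite -[RHS]B0; apply: eq_Rintegral => x _; rewrite addrC.
apply: (@filterS _ _ (ae_filter R)) ae => x Hx /Hx E.
have -> : u x = D + A x by rewrite -E subrK.
by congr (_ + _); apply: eq_Rintegral => y _; rewrite addrC.
Qed.

Lemma Rintegral_ae_eq (v w : R -> R) x : 0 <= x <= T ->
  mu.-integrable J (EFin \o v) -> mu.-integrable J (EFin \o w) ->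
  {ae mu, forall x, 0 < x < T -> v x = w x} ->
  \int[mu]_(t in `[0, x]) v t = \int[mu]_(t in `[0, x]) w t.
Proof.
move=> /andP[x0 xT] iv iw vw; rewrite /Rintegral; congr fine.
apply: ae_eq_integral => //.
- by case/integrableP : (integrable_prefix xT iv).
- by case/integrableP : (integrable_prefix xT iw).
have h0 := ae_neq (0 : R); have hT := ae_neq T.
have F := ae_filter R.
have h0T := @filterI _ _ F _ _ vw (@filterI _ _ F _ _ h0 hT).
have : {ae mu, forall y, 0 <= y <= x -> v y = w y}.
  apply: (@filterS _ _ F) h0T => y [vwy [y0 yT]] /andP[y0' yx]; apply: vwy.
  by rewrite !lt_neqAle eq_sym y0 y0' yT (le_trans yx xT).
by apply: (@filterS _ _ F) => y vwy /=; rewrite in_itv/= => /vwy ->.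
Qed.

Lemma within_continuous_addl (C : R) (F : R -> R) : {within J, continuous F} ->
  {within J, continuous (fun x => C + F x)}.
Proof. by move=> cF x; apply: continuousD; [exact: cst_continuous|exact: cF]. Qed.

Lemma primitive_affine_primitive (v : R -> R) C D :
  let b1 := fun x => C + \int[mu]_(t in `[0, x]) v t in
  let b := fun x => D + \int[mu]_(t in `[0, x]) b1 t in
  mu.-integrable J (EFin \o v) -> primitive b b1.
Proof.
move=> b1 b iv; have cV := Rintegral_continuous (ltW (pi2_gt0 R)) iv.
have cb1 : {within J, continuous b1}.
  exact: within_continuous_addl.
have P := primitiveD (primitive_cst D) (primitive_Rintegral cb1).
by apply: primitive_eq P _ => x _; rewrite add0r.
Qed.

Lemma primitive_ae_eq (v w : R -> R) C :
  let b1 := fun x => C + \int[mu]_(t in `[0, x]) v t in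
  mu.-integrable J (EFin \o v) -> {within J, continuous w} ->
  {ae mu, forall x, 0 < x < T -> v x = w x} -> primitive b1 w.
Proof.
move=> b1 iv cw vw; have iw := within_continuous_integrable cw.
have cV := Rintegral_continuous (ltW (pi2_gt0 R)) iv.
split; first exact: within_continuous_addl.
move=> x x02; have /(_ x x02) P := (primitiveD (primitive_cst C) (primitive_Rintegral cw)).2.
have Ex y : 0 <= y <= T -> b1 y = C + \int[mu]_(t in `[0, y]) w t.
  by move=> yT; congr (_ + _); exact: Rintegral_ae_eq.
move: P; rewrite add0r; apply: near_eq_is_derive => //.
move: x02 => /andP[x0 xT]; near=> y; rewrite Ex//.
by apply/andP; split; apply: ltW; near: y; [exact: lt_nbhsr|exact: lt_nbhsl].
Unshelve. all: by end_near. Qed.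

Lemma affine_primitive_periodic (v : R -> R) (C : R) : \int[mu]_(x in J) v x = 0 ->
  let b := fun x => C + \int[mu]_(t in `[0, x]) v t in b 0 = b T.
Proof. by move=> v0 b; rewrite /b set_itv1 Rintegral_set1 v0. Qed.

(** The clause on w is the gain of regularity: if v turns out to agree almost
    everywhere with a continuous function, which for an equation v = N(u) follows
    from the continuity of b, then b is of class C^2. *)
Lemma weak_derivative2_regular (u v : R -> R) :
  mu.-integrable J (EFin \o u) -> mu.-integrable J (EFin \o v) ->
  (forall s, trig s -> \int[mu]_(x in J) (derive1n 2 s x * u x) =
                       \int[mu]_(x in J) (s x * v x)) ->
  exists b b1, [/\ primitive b b1 /\ {ae mu, forall x, 0 < x < T -> u x = b x},
    forall w, {within J, continuous w} ->
      {ae mu, forall x, 0 < x < T -> v x = w x} -> primitive b1 w,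
    b 0 = b T & b1 0 = b1 T].
Proof.
move=> iu iv uv; have [C [D [v0 b10 ub]]] := weak_derivative2_primitive iu iv uv.
pose b1 x := C + \int[mu]_(t in `[0, x]) v t.
exists (fun x => D + \int[mu]_(t in `[0, x]) b1 t), b1; split.
- by split; first exact: primitive_affine_primitive.
- by move=> w; exact: primitive_ae_eq.
- exact: affine_primitive_periodic.
- exact: affine_primitive_periodic.
Qed.

End Regularity.

(** * Weak solutions on the torus *)

Section TorusFunctions.
Context {R : realType}.
Notation mu := (@lebesgue_measure R).
Notation T := (2 * pi : R).
Notation J := `[0, T]%classic.

Lemma ReM_real (k : R) (z : R[i]) : complex.Re (k%:C%C * z) = k * complex.Re z.
Proof. by case: z => x y /=; rewrite mul0r subr0. Qed.

Lemma ImM_real (k : R) (z : R[i]) : complex.Im (k%:C%C * z) = k * complex.Im z.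
Proof. by case: z => x y /=; rewrite mul0r addr0. Qed.

(** A period has finite measure, and |g| <= 1 + g^2. *)
Lemma torus_L2_integrable (u : R -> R[i]) : torus_L2 u ->
  mu.-integrable J (EFin \o (fun x => complex.Re (u x))) /\
  mu.-integrable J (EFin \o (fun x => complex.Im (u x))).
Proof.
move=> [_ mRe mIm fin].
have E x : complex.Re (`|u x| ^+ 2) = complex.Re (u x) ^+ 2 + complex.Im (u x) ^+ 2.
  by rewrite -add_Re2_Im2.
have mN D : measurable_fun D (fun x => complex.Re (`|u x| ^+ 2)).
  apply: (@measurable_funS _ _ _ _ setT) => //.
  rewrite (_ : (fun _ => _) = fun x => complex.Re (u x) ^+ 2 + complex.Im (u x) ^+ 2).
    by apply: measurable_funD; apply: measurable_funX.
  exact/funext.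
have mE D : measurable_fun D (fun x => (complex.Re (`|u x| ^+ 2))%:E).
  by apply/measurable_EFinP; exact: mN.
have dom (g : R -> R) : measurable_fun [set: R] g ->
    (forall x, g x ^+ 2 <= complex.Re (u x) ^+ 2 + complex.Im (u x) ^+ 2) ->
    mu.-integrable J (EFin \o g).
  move=> mg gle.
  have iN : mu.-integrable J (EFin \o (fun x => 1 + complex.Re (`|u x| ^+ 2))).
    rewrite (_ : _ \o _ = fun x => 1%:E + (complex.Re (`|u x| ^+ 2))%:E)%E//.
    apply: (integrableD _ (integrable_cst 0 T 1)) => //.
    apply/integrableP; split.
      exact: mE.
    under eq_integral => x _ do
      rewrite (gee0_abs (x := (complex.Re (`|u x| ^+ 2))%:E)) ?lee_fin ?E ?addr_ge0 ?sqr_ge0// -?E.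
    exact: fin.
  apply: le_integrable iN => //.
    by apply/measurable_EFinP; apply: (@measurable_funS _ _ _ _ setT).
  move=> x _; change (`|g x|%:E <= `|1 + complex.Re (`|u x| ^+ 2)|%:E)%E.
  rewrite lee_fin E.
  have H := gle x; rewrite [leRHS]ger0_norm; last first.
    by apply: addr_ge0 => //; apply: addr_ge0; exact: sqr_ge0.
  rewrite -lerBlDl (le_trans _ H)// -[in leRHS](real_normK (num_real (g x))).
  by have := sqr_ge0 (`|g x| - 1); have := normr_ge0 (g x); nra.
split; apply: dom => // x; first by rewrite lerDl sqr_ge0.
by rewrite lerDr sqr_ge0.
Qed.

Lemma weak_derivative2_Re_Im (u v : R -> R[i]) : weak_derivative 2 u v ->
  forall s, trig s ->
  \int[mu]_(x in J) (derive1n 2 s x * complex.Re (u x)) =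
    \int[mu]_(x in J) (s x * complex.Re (v x)) /\
  \int[mu]_(x in J) (derive1n 2 s x * complex.Im (u x)) =
    \int[mu]_(x in J) (s x * complex.Im (v x)).
Proof.
move=> uv s /trig_test /uv; rewrite sqrrN expr1n mul1r /torus_integral => -[HR HI].
split.
  transitivity (\int[mu]_(x in J) complex.Re ((derive1n 2 s x)%:C%C * u x)).
    by apply: eq_Rintegral => x _; rewrite ReM_real.
  by rewrite HR; apply: eq_Rintegral => x _; rewrite ReM_real.
transitivity (\int[mu]_(x in J) complex.Im ((derive1n 2 s x)%:C%C * u x)).
  by apply: eq_Rintegral => x _; rewrite ImM_real.
by rewrite HI; apply: eq_Rintegral => x _; rewrite ImM_real.
Qed.

Lemma lle_pointwise (d zeta kappa f : R) (a a'' : R[i]) :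
  - (d%:C%C * a'') - ('i%C - zeta%:C%C) * a
    - (1 + 'i%C * kappa%:C%C) * `|a| ^+ 2 * a + 'i%C * f%:C%C = 0 ->
  let r := complex.Re a ^+ 2 + complex.Im a ^+ 2 in
  d * complex.Re a'' = complex.Im a + zeta * complex.Re a - r * complex.Re a
     + kappa * (r * complex.Im a) /\
  d * complex.Im a'' = - complex.Re a + zeta * complex.Im a - r * complex.Im a
     - kappa * (r * complex.Re a) + f.
Proof.
rewrite -add_Re2_Im2; case: a => x y; case: a'' => x2 y2 /= [].
move: (x ^+ 2 + y ^+ 2) => r.
rewrite !(mul0r, mulr0, mul1r, subr0, sub0r, addr0, add0r, oppr0).
by move=> HR HI; split; lra.
Qed.

End TorusFunctions.

Theorem theorem3 (R : realType) (d kappa zeta f : R)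
    (hd : d != 0) (hkappa : 0 < kappa)
    (hstar : kappa_star d f < kappa)
    (a : R -> complex R) (ha : lle_solution d zeta kappa f a) :
  torus_constant a.
Proof.
have [[aL2 _] [a'' [a2L2 wd eqn]]] := ha.
have [iRe iIm] := torus_L2_integrable aL2.
have [iRe2 iIm2] := torus_L2_integrable a2L2.
have W := weak_derivative2_Re_Im wd.
have [b [b1 [[Pb aeb] Pb1 bT b1T]]] :=
  weak_derivative2_regular iRe iRe2 (fun s ts => (W s ts).1).
have [c [c1 [[Pc aec] Pc1 cT c1T]]] :=
  weak_derivative2_regular iIm iIm2 (fun s ts => (W s ts).2).
have F := ae_filter R.
have E : {ae lebesgue_measure, forall x : R, 0 < x < 2 * pi ->
   [/\ a x = (b x +i* c x)%C, complex.Re (a'' x) = lle_re zeta kappa b c x / d &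
      complex.Im (a'' x) = lle_im zeta kappa f b c x / d]}.
  apply: (@filterS _ _ F) (@filterI _ _ F _ _ eqn (@filterI _ _ F _ _ aeb aec)).
  move=> x [] /lle_pointwise[e1 e2] [+ +] x02 => /(_ x02) bx /(_ x02) cx.
  split; first by case: (a x) bx cx => /= ? ? -> ->.
    by rewrite /lle_re /sqmod -bx -cx -e1 mulrC mulKf.
  by rewrite /lle_im /sqmod -bx -cx -e2 mulrC mulKf.
have cre : {within `[0, 2 * pi]%classic, continuous (fun x => lle_re zeta kappa b c x / d)}.
  rewrite (_ : (fun x => _) = (fun x => d^-1 * lle_re zeta kappa b c x)).
    exact: (primitiveZ d^-1 (primitive_lle_re zeta kappa Pb Pc)).1.
  by apply/funext => x; rewrite mulrC.
have cim : {within `[0, 2 * pi]%classic, continuous (fun x => lle_im zeta kappa f b c x / d)}.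
  rewrite (_ : (fun x => _) = (fun x => d^-1 * lle_im zeta kappa f b c x)).
    exact: (primitiveZ d^-1 (primitive_lle_im zeta kappa f Pb Pc)).1.
  by apply/funext => x; rewrite mulrC.
have {}Pb1 : primitive b1 (fun x => lle_re zeta kappa b c x / d).
  apply: Pb1; first exact: cre.
  by apply: (@filterS _ _ F) E => x H /H[].
have {}Pc1 : primitive c1 (fun x => lle_im zeta kappa f b c x / d).
  apply: Pc1; first exact: cim.
  by apply: (@filterS _ _ F) E => x H /H[].
have bc := lle_classical_constant hd hkappa Pb Pc Pb1 Pc1 bT cT b1T c1T hstar.
exists (b 0 +i* c 0)%C; apply: (ae_periodic (pi2_gt0 R)).
  by move=> x; have [-> _ _ _] := aL2.
apply: (@filterS _ _ F) E => x H x02; have [-> _ _] := H x02.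
by move: x02 => /andP[/ltW x0 /ltW xT]; have [|-> ->] := bc x; rewrite ?x0.
Qed.
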